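(* Let $(X,f_{1,\infty})$ be a non-autonomous discrete dynamical system. If the Furstenberg family $\mathcal{F}$ is filterdual and is compatible with the system $(X\times X, f_{1,\infty}\times f_{1,\infty})$, then the following are equivalent. (1) $(X,f_{1,\infty})$ is weakly $\mathcal{F}$-sensitive. (2) There exists $\delta>0$ such that for every $x\in X$, $Asym_{\delta}(\mathcal{F})(x)$ is a first category subset of $X$. (3) There exists $\delta>0$ such that $Asym_{\delta}(\mathcal{F})$ is a first category subset of $X\times X$. (4) There exists $\delta>0$ such that $\mathcal{F}(X\times X\setminus\overline{V_{\delta}})$ is dense in $X\times X$. (5) $(X,f_{1,\infty})$ is $\mathcal{F}$-sensitive.
   Context: A non-autonomous discrete dynamical system $(X,f_{1,\infty})$ consists of a compact metric space $(X,d)$ and a sequence $f_{1,\infty}=(f_n)_{n\ge 1}$ of continuous maps $f_n:X\to X$. Write $f_1^n=f_n\circ\cdots\circ f_1$ for $n\ge1$. For $x\in X$ and $A\subseteq X$, $N_{f_{1,\infty}}(x,A)=\{n\in\mathbb{N}: f_1^n(x)\in A\}$. The product system $(X\times X,f_{1,\infty}\times f_{1,\infty})$ is the non-autonomous system given by the sequence $f_n\times f_n$ on $X\times X$ with the product metric $d((x,y),(x',y'))=d(x,x')+d(y,y')$. Let $\mathbb{Z}^+=\mathbb{N}$ denote the positive integers and let $\mathcal{P}$ be the collection of all subsets of $\mathbb{Z}^+$. A Furstenberg family is a collection $\mathcal{F}\subseteq\mathcal{P}$ that is hereditary upwards: $F_1\subset F_2$ and $F_1\in\mathcal{F}$ imply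 $F_2\in\mathcal{F}$. All Furstenberg families are assumed proper, i.e. $\mathcal{F}\neq\emptyset$ and $\mathcal{F}\neq\mathcal{P}$. The dual family is $k\mathcal{F}=\{F\in\mathcal{P}: F\cap F'\neq\emptyset \text{ for all } F'\in\mathcal{F}\}=\{F\in\mathcal{P}:\mathbb{Z}^+\setminus F\notin\mathcal{F}\}$. Put $\mathcal{F}_1\cdot\mathcal{F}_2=\{F_1\cap F_2: F_1\in\mathcal{F}_1,F_2\in\mathcal{F}_2\}$. $\mathcal{F}$ is filterdual if it is proper and $k\mathcal{F}\cdot k\mathcal{F}\subseteq k\mathcal{F}$. For a system $(Y,g_{1,\infty})$ and $A\subseteq Y$, the $\mathcal{F}$-attaching set of $A$ is $\mathcal{F}(A)=\{y\in Y: N_{g_{1,\infty}}(y,A)\in\mathcal{F}\}$. $\mathcal{F}$ is compatible with $(Y,g_{1,\infty})$ if $\mathcal{F}(U)$ is a $G_\delta$ subset of $Y$ for each open $U\subseteq Y$. For $\delta>0$, $\overline{V_\delta}=\{(x,y)\in X\times X: d(x,y)\le\delta\}$. The attaching set $\mathcal{F}(X\times X\setminus\overline{V_\delta})$ is taken in the product system $(X\times X,f_{1,\infty}\times f_{1,\infty})$, i.e. it is the set of $(x,y)$ with $\{n\in\mathbb{N}: d(f_1^n(x),f_1^n(y))>\delta\}\in\mathcal{F}$. Also $Asym_\delta(\mathcal{F})=k\mathcal{F}(\overline{V_\delta})=\{(x,y)\in X\times X:\{n\in\mathbb{N}: d(f_1^n(x),f_1^n(y))\le\delta\}\in k\mathcal{F}\}$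 and $Asym_\delta(\mathcal{F})(x)=\{y\in X:(x,y)\in Asym_\delta(\mathcal{F})\}$. $(X,f_{1,\infty})$ is weakly $\mathcal{F}$-sensitive if there exists $\delta>0$ such that every non-empty open $U\subseteq X$ contains points $x,y$ with $\{n\in\mathbb{N}: d(f_1^n(x),f_1^n(y))>\delta\}\in\mathcal{F}$. $(X,f_{1,\infty})$ is $\mathcal{F}$-sensitive if there exists $\delta>0$ such that for every $x\in X$ and every open neighbourhood $U$ of $x$ there exists $y\in U$ such that $(x,y)$ is not $\mathcal{F}$-$\delta$-asymptotic, i.e. $\{n\in\mathbb{N}: d(f_1^n(x),f_1^n(y))>\delta\}\in\mathcal{F}$. *)

(* Defs.v *)
From mathcomp Require Import all_boot all_order all_algebra.
From mathcomp Require Import boolp classical_sets reals topology.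
From mathcomp Require Export metric_structure borel_hierarchy.

Set Implicit Arguments.
Unset Strict Implicit.
Unset Printing Implicit Defensive.

Import Order.TTheory GRing.Theory Num.Theory.
Local Open Scope classical_set_scope.
Local Open Scope ring_scope.

(* The positive integers; every time index and every Furstenberg family below
   lives over this type, so that 0 plays no role. *)
Definition posint := {n : nat | (0 < n)%N}.

Definition posintS (n : nat) : posint := exist _ n.+1 (ltn0Sn n).

Section Families.
Implicit Types F : set (set posint).

Definition hereditary_upwards F :=
  forall A B : set posint, A `<=` B -> F A -> F B.

Definition proper_family F := F !=set0 /\ F <> [set: set posint].

Definition furstenberg_family F := hereditary_upwards F /\ proper_family F.

Definition dual_family F : set (set posint) :=
  [set A | forall B, F B -> A `&` B !=set0].

Lemma dual_familyE F : hereditary_upwards F ->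
  dual_family F = [set A | ~ F (~` A)].
Proof.
move=> Fup; apply/seteqP; split => A /= HA.
  by move=> /HA[x []].
move=> B FB; apply: contrapT => AB0; apply: HA; apply: Fup FB => x Bx Ax.
by apply: AB0; exists x.
Qed.

Definition family_meet F1 F2 : set (set posint) :=
  [set C | exists A B, [/\ F1 A, F2 B & C = A `&` B]].

Definition filterdual F :=
  proper_family F /\
  family_meet (dual_family F) (dual_family F) `<=` dual_family F.

End Families.

Section Orbits.
Context {Y : Type}.
Implicit Types (g : posint -> Y -> Y) (F : set (set posint)).

Fixpoint compose_first g (n : nat) (y : Y) : Y :=
  if n is m.+1 then g (posintS m) (compose_first g m y) else y.

(* g_1^n = g_n \o ... \o g_1, for n >= 1 *)
Definition iterates g (n : posint) : Y -> Y := compose_first g (sval n).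

Definition hitting_times g (y : Y) (A : set Y) : set posint :=
  [set n | A (iterates g n y)].

Definition attaching_set F g (A : set Y) : set Y :=
  [set y | F (hitting_times g y A)].

Definition product_maps g (n : posint) (p : Y * Y) : Y * Y :=
  (g n p.1, g n p.2).

End Orbits.

Lemma iterates_product Y (g : posint -> Y -> Y) n (p : Y * Y) :
  iterates (product_maps g) n p = (iterates g n p.1, iterates g n p.2).
Proof.
case: n => n n0; rewrite /iterates /=; elim: n {n0} => [|n IH] /=.
  by case: p.
by rewrite IH.
Qed.

Section Category.
Context {T : topologicalType}.

Definition compatible (F : set (set posint)) (g : posint -> T -> T) :=
  forall U : set T, open U -> Gdelta (attaching_set F g U).

Definition nowhere_dense (A : set T) := interior (closure A) = set0.

Definition first_category (A : set T) :=
  exists2 N : nat -> set T, (forall i, nowhere_dense (N i)) &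
    A = \bigcup_i N i.

End Category.

Section Systems.
Context {R : realType} {X : metricType R}.
Implicit Types (f : posint -> X -> X) (F : set (set posint)) (delta : R).

(* X * X carries the library's product topology; this is the topology of the
   metric d((x,y),(x',y')) = d(x,x') + d(y,y'). *)
Lemma nbhs_sum_metric (p : X * X) (A : set (X * X)) :
  nbhs p A <->
  exists2 e : R, 0 < e &
    [set q : X * X | mdist p.1 q.1 + mdist p.2 q.2 < e] `<=` A.
Proof.
split.
  move=> /nbhs_ballP[e /= e0 eA]; exists e => // q /= qe; apply: eA.
  split; rewrite ballEmdist /=; apply: le_lt_trans qe.
    by rewrite lerDl mdist_ge0.
  by rewrite lerDr mdist_ge0.
move=> [e e0 eA]; apply/nbhs_ballP; exists (e / 2) => /=; first exact: divr_gt0.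
move=> q [q1 q2]; apply: eA => /=; move: q1 q2; rewrite !ballEmdist /=.
by move=> q1 q2; rewrite [e]splitr ltrD.
Qed.

Definition nonautonomous_system f :=
  compact [set: X] /\ forall n, continuous (f n).

Definition Vbar delta : set (X * X) := [set p | mdist p.1 p.2 <= delta].

Definition Asym delta F f : set (X * X) :=
  attaching_set (dual_family F) (product_maps f) (Vbar delta).

Definition Asym_at delta F f (x : X) : set X := [set y | Asym delta F f (x, y)].

Definition separation_times f delta (x y : X) : set posint :=
  [set n | delta < mdist (iterates f n x) (iterates f n y)].

Definition weakly_sensitive F f :=
  exists2 delta : R, 0 < delta &
    forall U : set X, open U -> U !=set0 ->
      exists x y, [/\ U x, U y & F (separation_times f delta x y)].

Definition sensitive F f :=
  exists2 delta : R, 0 < delta &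
    forall (x : X) (U : set X), open_nbhs x U ->
      exists2 y, U y & F (separation_times f delta x y).

End Systems.

Arguments Vbar {R} X delta.

(* Main.v *)
(* Filterduality of F says that whenever A `|` B is in F, A or B is; so by the
   triangle inequality, if the orbits of y and z are delta-separated along F,
   then the orbit of any x is (delta / 2)-separated along F from that of y or
   of z.  Compatibility makes Asym delta F f an F-sigma set, and an F-sigma set
   with dense complement is of first category, while conversely, by Baire's
   theorem for compact regular spaces, sets of first category in X and X * X
   have dense complement. *)
Require Import Defs.
From mathcomp Require Import all_boot all_order all_algebra.
From mathcomp Require Import boolp classical_sets reals topology.
From mathcomp Require Import lra.

Set Implicit Arguments.
Unset Strict Implicit.
Unset Printing Implicit Defensive.

Import Order.TTheory GRing.Theory Num.Theory.
Local Open Scope classical_set_scope.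
Local Open Scope ring_scope.

Section Baire.
Context {T : topologicalType}.

(** [closure N] has empty interior, so it cannot cover [U]. Regularity at a point [z] of the open
    set left over gives a neighbourhood whose closure stays there, and [V] is its interior. *)
Lemma regular_shrink (U N : set T) : regular_space T ->
  open U -> U !=set0 -> nowhere_dense N ->
  exists V, [/\ open V, V !=set0 & closure V `<=` U `\` closure N].
Proof.
move=> regT oU [u Uu] ndN.
have oUN : open (U `\` closure N).
  by apply: openI => //; exact/closed_openC/closed_closure.
have [z UNz] : U `\` closure N !=set0.
  apply: contrapT => UN0.
  suff : set0 u by [].
  rewrite -ndN; apply: filterS (open_nbhs_nbhs (conj oU Uu)) => v Uv.
  by apply: contrapT => Nv; apply: UN0; exists v.
have [W zW WUN] := regT z (U `\` closure N) (open_nbhs_nbhs (conj oUN UNz)).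
exists (W°); split; first exact: open_interior.
  by exists z; exact: zW.
by apply: subset_trans WUN; exact: closureS (@interior_subset _ _).
Qed.

Lemma compact_regular_Baire (A : set T) :
  compact [set: T] -> regular_space T -> first_category A -> dense (~` A).
Proof.
move=> cT regT [N ndN ->] O O0 oO.
(* The condition on [nU.2] sits under the existential so that [choice] yields a total function;
   [set0] is the default where it fails. *)
have step (nU : nat * set T) : exists V, open nU.2 /\ nU.2 !=set0 ->
    [/\ open V, V !=set0 & closure V `<=` nU.2 `\` closure (N nU.1)].
  case: (pselect (open nU.2 /\ nU.2 !=set0)) => [[oU U0]|nU0]; last by exists set0.
  by have [V] := regular_shrink regT oU U0 (ndN nU.1); exists V.
have [s sP] := choice step.
pose W := fix W n := if n is m.+1 then s (m, W m) else O.
have WP n : open (W n) /\ W n !=set0.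
  by elim: n => [|n /(sP (n, W n))[? ? _]] //=.
have WS n : closure (W n.+1) `<=` W n `\` closure (N n).
  by have [] := sP (n, W n) (WP n).
have Wle m n : (m <= n)%N -> W n `<=` W m.
  move=> /subnK <-; elim: (n - m)%N => // k IH.
  by rewrite addSn => x /subset_closure/WS[/IH].
(* The decreasing nonempty sets [W n] form a filter base, and a cluster point of it lies in the
   closure of every [W n]. *)
have FW : ProperFilter (filter_from [set: nat] W).
  apply: filter_from_proper => [|n _]; last by have [] := WP n.
  apply: filter_from_filter; first by exists 0%N.
  move=> i j _ _; exists (maxn i j) => // x Wx.
  by split; apply: Wle Wx; rewrite ?leq_maxl ?leq_maxr.
have [|p [_]] := cT _ FW; first by exists 0%N.
rewrite clusterE => Wp.
have {}Wp n : (W n `\` closure (N n)) p by apply/WS/Wp; exists n.+1.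
exists p; split; first by have [] := Wp 0%N.
by move=> [i _ /subset_closure Np]; have [_] := Wp i; exact.
Qed.

Lemma Fsigma_first_category (A : set T) :
  Fsigma A -> dense (~` A) -> first_category A.
Proof.
move=> [C cC AC] dA; exists C => // i.
rewrite /nowhere_dense -(closure_id _).1 //; rewrite -subset0 => x Cx.
have [|y [/interior_subset Cy nAy]] := dA (C i)° _ (@open_interior _ _).
  by exists x.
by apply: nAy; rewrite AC; exists i.
Qed.

Lemma Fsigma_preimage (U : topologicalType) (g : U -> T) (A : set T) :
  continuous g -> Fsigma A -> Fsigma (g @^-1` A).
Proof.
move=> cg [C cC ->]; exists (fun i => g @^-1` C i); last by rewrite preimage_bigcup.
by move=> i; exact: closed_comp.
Qed.

Lemma pair_continuous (U : topologicalType) (x : U) :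
  continuous (fun y : T => (x, y)).
Proof. by move=> y; apply: cvg_pair => //; exact: cvg_cst. Qed.

End Baire.

(** If both sets were outside [F], their complements, and hence the intersection of these, would lie
    in the dual family. *)
Lemma filterdual_setU (F : set (set posint)) (A B : set posint) :
  hereditary_upwards F -> filterdual F -> F (A `|` B) -> F A \/ F B.
Proof.
move=> Fup [_ kF] FAB; apply: contrapT => /not_orP[nFA nFB].
suff : dual_family F (~` A `&` ~` B).
  by rewrite dual_familyE //= -setCU setCK.
apply: kF; exists (~` A), (~` B).
by split => //; rewrite dual_familyE //= setCK.
Qed.

Section Systems.
Context {R : realType} {X : metricType R}.
Implicit Types (f : posint -> X -> X) (F : set (set posint)) (delta : R).

Lemma open_VbarC delta : open (~` Vbar X delta).
Proof.
rewrite openE => p /=; rewrite /Vbar /= => /negP; rewrite -ltNge => dp.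
(* Moving from [p] to [q] lowers the distance between coordinates by at most the sum-metric
   distance, so the excess over [delta] is a safe radius. *)
apply/nbhs_sum_metric; exists (mdist p.1 p.2 - delta); first by rewrite subr_gt0.
move=> q /= pq; apply/negP; rewrite -ltNge.
have t1 := metric_triangle p.1 q.1 p.2.
have t2 := metric_triangle q.1 q.2 p.2.
rewrite (metric_sym q.2) in t2.
lra.
Qed.

Lemma attaching_VbarC F f delta (p : X * X) :
  attaching_set F (product_maps f) (~` Vbar X delta) p =
  F (separation_times f delta p.1 p.2).
Proof.
congr F; apply/seteqP; split => n /=; rewrite /hitting_times /= iterates_product.
  by move=> /negP; rewrite -ltNge.
by rewrite /separation_times /= ltNge => /negP.
Qed.

Lemma AsymE F f delta : hereditary_upwards F ->
  Asym delta F f = ~` attaching_set F (product_maps f) (~` Vbar X delta).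
Proof. by move=> Fup; rewrite /Asym /attaching_set dual_familyE. Qed.

Lemma AsymC F f delta (p : X * X) : hereditary_upwards F ->
  (~` Asym delta F f) p = F (separation_times f delta p.1 p.2).
Proof. by move=> Fup; rewrite AsymE // setCK attaching_VbarC. Qed.

Lemma Fsigma_Asym F f delta : hereditary_upwards F ->
  compatible F (product_maps f) -> Fsigma (Asym delta F f).
Proof.
move=> Fup /(_ _ (@open_VbarC delta))[G oG GE]; rewrite AsymE // GE.
by exists (fun i => ~` G i); [move=> i; exact: open_closedC|rewrite setC_bigcap].
Qed.

Lemma separation_triangle F f delta (x y z : X) :
  hereditary_upwards F -> filterdual F ->
  F (separation_times f delta y z) ->
  F (separation_times f (delta / 2) x y) \/
  F (separation_times f (delta / 2) x z).
Proof.
move=> Fup fdF Fyz; apply: filterdual_setU => //; apply: Fup Fyz => n /=.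
rewrite /separation_times /= => dyz; apply: contrapT => /not_orP.
case=> /negP; rewrite -leNgt => dxy /negP; rewrite -leNgt => dxz.
have := metric_triangle (iterates f n y) (iterates f n x) (iterates f n z).
rewrite (metric_sym (iterates f n y) (iterates f n x)); lra.
Qed.

End Systems.

Theorem theorem3p2 (R : realType) (X : metricType R) (f : posint -> X -> X)
    (F : set (set posint)) :
  nonautonomous_system f ->
  furstenberg_family F ->
  filterdual F ->
  compatible F (product_maps f) ->
  [<-> weakly_sensitive F f;
       exists2 delta : R, 0 < delta &
         forall x : X, first_category (Asym_at delta F f x);
       exists2 delta : R, 0 < delta & first_category (Asym delta F f);
       exists2 delta : R, 0 < delta &
         dense (attaching_set F (product_maps f) (~` Vbar X delta));
       sensitive F f ].
Proof.
move=> [cX _] [Fup _] fdF compF; tfae.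
- move=> [delta d0 sF]; exists (delta / 2); first by rewrite divr_gt0.
  move=> x; apply: Fsigma_first_category.
    apply: (@Fsigma_preimage _ _ (fun y => (x, y)) (Asym (delta / 2) F f)).
      exact: pair_continuous.
    exact: Fsigma_Asym.
  (* One of the two separated points of [U] must be [delta / 2]-separated from [x] along [F], so it
     avoids the fibre over [x]. *)
  move=> U U0 oU; have [y [z [Uy Uz Fyz]]] := sF U oU U0.
  have [Fxy|Fxz] := separation_triangle x Fup fdF Fyz.
    exists y; split => //.
    by change ((~` Asym (delta / 2) F f) (x, y)); rewrite AsymC.
  exists z; split => //.
  by change ((~` Asym (delta / 2) F f) (x, z)); rewrite AsymC.
- move=> [delta d0 fcA]; exists delta => //.
  apply: Fsigma_first_category; first exact: Fsigma_Asym.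
  (* Baire is applied in [X], to the slice of [O] over [x]; no Kuratowski-Ulam argument is
     needed. *)
  move=> O [[x y] Oxy] oO.
  have [||y' [Oy' Ay']] := compact_regular_Baire cX uniform_regular (fcA x)
      (O := (fun y => (x, y)) @^-1` O).
  + by exists y.
  + by apply: open_comp => // y0 _; exact: pair_continuous.
  by exists (x, y').
- move=> [delta d0 fcA]; exists delta => //.
  rewrite -[attaching_set _ _ _]setCK -AsymE //.
  apply: compact_regular_Baire fcA; last exact: uniform_regular.
  by rewrite -setXTT; exact: compact_setX.
- move=> [delta d0 dG]; exists (delta / 2); first by rewrite divr_gt0.
  move=> x U [oU Ux].
  (* The box [U * U] contains [(x, x)], so density yields a separated pair with both points in
     [U]. *)
  have [||[y z] [[/= Uy Uz]]] := dG (U `*` U).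
  + by exists (x, x).
  + rewrite openE => p [/= Up1 Up2]; exists (U, U) => //.
    by split; apply: open_nbhs_nbhs.
  rewrite attaching_VbarC => /(separation_triangle x Fup fdF)[Fxy|Fxz].
    by exists y.
  by exists z.
- move=> [delta d0 sF]; exists delta => // U oU [x Ux].
  by have [y Uy Fxy] := sF x U (conj oU Ux); exists x, y.
Qed.
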